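(* Let $\mathbb G=(\mathbb V,\mathbb E)$ be a countably infinite, locally finite, connected graph with edge weights $\mathbf c_e\ge1$, and fix $x\in\mathbb V$. Suppose that the infinite-volume wired FK-Ising measure ${\sf P}^{\mathbb G,+}_{\rm FK}$ with edge parameters $p_e=1-1/\mathbf c_e$ almost surely has an infinite cluster. Then there exists $C>0$ such that for every finite connected subgraph $D=(V,E)$ of $\mathbb G$ with $x\in V$, $$\mathrm{Var}^1_D(h(x))\le C,$$ where $\mathrm{Var}^1_D$ denotes the variance under $\mathbb P^1_D$.
   Context: Height functions: $\mathbb Z_{\rm odd}=2\mathbb Z+1$. For a finite connected graph $D=(V,E)$ with weights $\mathbf c_e\ge1$, a height function is $h:V\to\mathbb Z_{\rm odd}$ with $|h(v)-h(w)|\le2$ for all edges $\langle v,w\rangle$; its weight is $W(h)=\prod_{e=\langle v,w\rangle\in E}\mathbf c_e^{\mathbb 1\{h(v)=h(w)\}}$. For a finite connected subgraph $D$ of $\mathbb G$, $\partial D$ is the set of vertices of $D$ incident to an edge of $\mathbb E\setminus E$, and $\mathbb P^1_D$ is the probability measure on height functions on $D$ with $h\equiv1$ on $\partial D$ and probabilities proportional to $W(h)$ (weights of $\mathbb G$ restricted to $E$). FK-Ising model: on a finite graph $\mathcal D=(\mathcal V,E)$ with parameters $p_e\in[0,1]$, ${\sf P}_{\rm FK}[\varpi]\propto 2^{c(\varpi)}\prod_{e\in E}p_e^{\mathbb 1\{e\in\varpi\}}(1-p_e)^{\mathbb 1\{e\notin\varpi\}}$ for $\varpi\subset E$, where $c(\varpi)$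 is the number of connected components of $(\mathcal V,\varpi)$; the wired measure on $S\subset\mathcal V$ is the same model on the graph where all vertices of $S$ are identified. ${\sf P}^{\mathbb G,+}_{\rm FK}$ is the weak limit (on $\{0,1\}^{\mathbb E}$, as finite connected $D\uparrow\mathbb G$) of the FK-Ising measures on $D$ wired on $\partial D$; this limit exists and does not depend on the sequence. *)

(* Defs.v *)
From HB Require Import structures.
From mathcomp Require Import all_boot all_order all_algebra.
From mathcomp Require Import finmap.
From mathcomp Require Import all_classical all_reals all_analysis.

Set Implicit Arguments.
Unset Strict Implicit.
Unset Printing Implicit Defensive.

Import Order.TTheory GRing.Theory Num.Theory.
Import numFieldNormedType.Exports.
Local Open Scope classical_set_scope.

Local Open Scope ring_scope.

Section Graph.
Variable V : countType.
(* the (simple) graph G = (V, adj); edges are unordered pairs {u,v}          *)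
Variable adj : rel V.

(* canonical orientation of an edge: smaller pickle first *)
Definition edge_pred (p : V * V) : bool := adj p.1 p.2 && ltn (choice.pickle p.1) (choice.pickle p.2).
Definition edge := {p : V * V | edge_pred p}.

Definition efst (e : edge) : V := (val e).1.
Definition esnd (e : edge) : V := (val e).2.

Definition joins (e : edge) (u v : V) : bool :=
  ((efst e == u) && (esnd e == v)) || ((efst e == v) && (esnd e == u)).

Definition incident (v : V) (e : edge) : bool := (efst e == v) || (esnd e == v).

Definition locally_finite : Prop := forall v, finite_set [set w | adj v w].

Definition graph_connected : Prop :=
  forall u v : V, exists s : seq V, path adj u s /\ last u s = v.

Definition is_subgraph (VD : {fset V}) (ED : {fset edge}) : Prop :=
  forall e, e \in ED -> (efst e \in VD) && (esnd e \in VD).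

Definition linkE (S : {fset edge}) (u v : V) : bool := has (fun e => joins e u v) S.

Definition sub_connected (VD : {fset V}) (ED : {fset edge}) : Prop :=
  forall u v, u \in VD -> v \in VD ->
    exists s : seq V, path (linkE ED) u s /\ last u s = v.

Definition bdry (VD : {fset V}) (ED : {fset edge}) (v : V) : Prop :=
  v \in VD /\ exists e : edge, e \notin ED /\ incident v e.

Variable R : realType.
Variable c : edge -> R.

(* ---- height functions (represented as functions on V equal to 1 off VD) ---- *)
Definition height_fun (VD : {fset V}) (ED : {fset edge}) (h : V -> int) : Prop :=
  (forall v, v \notin VD -> h v = 1) /\
  (forall v, v \in VD -> exists k : int, h v = 2 * k + 1) /\
  (forall e, e \in ED -> `|h (efst e) - h (esnd e)| <= 2) /\
  (forall v, bdry VD ED v -> h v = 1).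

Definition heights (VD : {fset V}) (ED : {fset edge}) : set (V -> int) :=
  [set h | height_fun VD ED h].

Definition hweight (ED : {fset edge}) (h : V -> int) : R :=
  \prod_(e <- ED) (if h (efst e) == h (esnd e) then c e else 1).

Definition hZ (VD : {fset V}) (ED : {fset edge}) : R := \sum_(h \in heights VD ED) hweight ED h.

Definition hE (VD : {fset V}) (ED : {fset edge}) (f : (V -> int) -> R) : R :=
  (\sum_(h \in heights VD ED) hweight ED h * f h) / hZ VD ED.

Definition height_var (VD : {fset V}) (ED : {fset edge}) (x : V) : R :=
  hE VD ED (fun h => (h x)%:~R ^+ 2) - (hE VD ED (fun h => (h x)%:~R)) ^+ 2.

Definition pe (e : edge) : R := 1 - (c e)^-1.

Definition wired_rel (VD : {fset V}) (ED : {fset edge}) (w : {fset edge}) : rel VD :=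
  fun a b => linkE w (val a) (val b) ||
             (`[< bdry VD ED (val a) >] && `[< bdry VD ED (val b) >]).

Definition wired_ncomp (VD : {fset V}) (ED : {fset edge}) (w : {fset edge}) : nat :=
  n_comp (@wired_rel VD ED w) predT.

Definition fk_weight (VD : {fset V}) (ED : {fset edge}) (w : {fset edge}) : R :=
  2 ^+ wired_ncomp VD ED w *
  \prod_(e <- ED) (if e \in w then pe e else 1 - pe e).

Definition fk_cyl_prob (VD : {fset V}) (ED : {fset edge}) (F : {fset edge}) (xi : edge -> bool) : R :=
  (\sum_(w <- fpowerset ED | all (fun e => (e \in w) == xi e) F) fk_weight VD ED w)
  / (\sum_(w <- fpowerset ED) fk_weight VD ED w).

Definition config := edge -> bool.

Definition cyl (F : {fset edge}) (xi : edge -> bool) : set config :=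
  [set om | forall e, e \in F -> om e = xi e].

Definition cylinders : set (set config) :=
  [set A | exists F xi, A = cyl F xi].

Definition Omega := g_sigma_algebraType cylinders.

Definition exhaustion (D : nat -> {fset V} * {fset edge}) : Prop :=
  (forall n, is_subgraph (D n).1 (D n).2 /\ sub_connected (D n).1 (D n).2) /\
  (forall n, fsubset (D n).1 (D n.+1).1 /\ fsubset (D n).2 (D n.+1).2) /\
  (forall v, exists n, v \in (D n).1) /\
  (forall e, exists n, e \in (D n).2).

Definition wired_limit (mu : probability Omega R) : Prop :=
  forall D, exhaustion D -> forall (F : {fset edge}) (xi : edge -> bool),
    (fun n => fk_cyl_prob (D n).1 (D n).2 F xi) @ \oo --> fine (mu (cyl F xi)).

Definition open_link (om : config) (u v : V) : Prop :=
  exists e : edge, om e /\ joins e u v.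

Definition cluster (om : config) (v : V) : set V :=
  [set w | exists s : seq V, path (fun a b => `[< open_link om a b >]) v s /\ last v s = w].

Definition inf_cluster : set config :=
  [set om | exists v, infinite_set (cluster om v)].

End Graph.

(* Main.v *)
Require Import Defs.
From HB Require Import structures.
From mathcomp Require Import all_boot all_order all_algebra.
From mathcomp Require Import finmap.
From mathcomp Require Import all_classical all_reals all_analysis.
From mathcomp Require Import ring lra zify.
Import Order.TTheory GRing.Theory Num.Theory.
Import numFieldNormedType.Exports.
Local Open Scope classical_set_scope.
Local Open Scope ring_scope.

Set Implicit Arguments.
Unset Strict Implicit.
Unset Printing Implicit Defensive.
Local Open Scope fset_scope.
Local Open Scope ring_scope.

(**
  Conditionally on its absolute value, the sign of [h] is an Ising model: it can
  only change across edges whose endpoints both have height [1] or [-1], where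
  its FK parameter is [1 - 1/c]; all other edges are forced open.  By Holley's
  inequality this FK model dominates the wired model of any larger volume, so
  that, for a vertex [y] in an infinite cluster with probability [th > 0],
  [E(h(y)^3) = E(|h(y)|^3 sgn h(y)) >= th * E(|h(y)|^3)].
  The symmetry [h -> 2 - h] gives [E(h(y)^3) = 3 E(h(y)^2) - 2], and the two
  relations together bound the second moment of [h(y)] in terms of [th].  The
  bound is transported from [y] to [x] along a path, since a path leaving the
  domain meets the boundary, where [h] is [1].
*)

(** * The four functions theorem *)

(** The cube enters because the first power would only bound [E|h(y)|]. Reflection about 1 makes the
    third moment a quadratic quantity, so [th * E|h(y)|^3 <= 3 E(h(y)^2)], and a cubic moment can
    stay below a quadratic one only if both are bounded. Given [|h|], the factor [|h(y)|^3] is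
    constant, so only the sign has to be averaged. The sign at [y] is positive when [y] is joined to
    the boundary, where [h = 1], and otherwise flipping the cluster of [y] shows that its mean is at
    least 0. Being joined to the boundary depends only on the edges of the domain and is implied by
    an infinite cluster at [y]; it can therefore be tested by finitely many cylinders, for which the
    infinite-volume limit is known. Domination holds because soft edges have the odds [c - 1] of the
    FK model, while every other edge, inside or outside the domain, is forced open. The cluster
    factor [2^clusters] of the sign model appears as the number of admissible heights, and only its
    change when an edge is opened is needed. *)

Lemma fset_ind1U (K : choiceType) (P : {fset K} -> Prop) :
  P fset0 -> (forall e E, e \notin E -> P E -> P (e |` E)) -> forall E, P E.
Proof.
move=> P0 PS; apply: finSet_rect => E IH.
have [->//|[e eE]] := fset_0Vmem E.
rewrite -(fsetD1K eE); apply: PS; first by rewrite !inE eqxx.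
by apply: IH; exact: fproperD1.
Qed.

Lemma big_fpowersetU1 (K : choiceType) (V : nmodType) (e : K) (E : {fset K})
    (f : {fset K} -> V) : e \notin E ->
  \sum_(w <- fpowerset (e |` E)) f w
  = \sum_(w <- fpowerset E) (f w + f (e |` w)).
Proof.
move=> eE; rewrite (big_fsetIDcond _ (fun w : {fset K} => e \notin w)) big_split /=.
congr (_ + _).
  apply: congr_big => //; congr enum_fset; apply/fsetP => w.
  rewrite !inE /= !fpowersetE; apply/andP/idP => [[wE ew]|wE].
    apply/fsubsetP => u uw; move/fsubsetP: wE => /(_ u uw).
    by rewrite !inE => /orP[/eqP ue|//]; rewrite -ue uw in ew.
  split; first by rewrite (fsubset_trans wE)// fsubsetUr.
  by apply: contra eE; move/fsubsetP: wE; exact.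
have -> : [fset w in fpowerset (e |` E) | ~~ (e \notin w)] =
   [fset (e |` w) | w in fpowerset E].
  apply/fsetP => w; rewrite !inE /= fpowersetE negbK.
  apply/andP/imfsetP => [[wE ew]|[u /= uE ->]].
    exists (w `\ e); last by rewrite fsetD1K.
    by rewrite fpowersetE fsubDset.
  by rewrite !inE eqxx fsetUS// -fpowersetE.
rewrite big_imfset//= => u w.
rewrite !fpowersetE => uE wE euw.
have h (z : {fset K}) : z `<=` E -> (e |` z) `\ e = z.
  by move=> zE; rewrite fsetU1K//; apply: contra eE; move/fsubsetP: zE; exact.
by rewrite -(h u)// euw h.
Qed.

Lemma prod_add_fpowerset (K : choiceType) (R : comPzSemiRingType) (E : {fset K})
    (X Y : K -> R) :
  \prod_(e <- E) (X e + Y e)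
  = \sum_(w <- fpowerset E) \prod_(e <- E) (if e \in w then X e else Y e).
Proof.
elim/fset_ind1U: E => [|e E eE IH].
  by rewrite fpowerset0 big_seq_fset1 !big_seq_fset0.
rewrite big_fsetU1//= big_fpowersetU1// IH mulr_sumr; apply: eq_big_seq => w.
rewrite fpowersetE => wE; rewrite !big_fsetU1//=.
have ew : e \notin w by apply: contra eE; move/fsubsetP: wE; exact.
rewrite !inE eqxx /= (negPf ew) mulrDl [LHS]addrC; congr (_ + _); congr (_ * _).
rewrite [LHS]big_seq [RHS]big_seq; apply: eq_bigr => u uE; rewrite !inE.
by case: eqP => // ue; rewrite -ue uE in eE.
Qed.

(** Put [P = c1 * d0], [u = a0 * b1], [v = a1 * b0]. Since [u, v <= P], expanding
    [(P - u) * (P - v) >= 0] gives [(u + v) * P <= P^2 + u * v], and [u * v <= c0 * d1 * P]. The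
    case [P = 0], where [u = v = 0], is separate because the argument divides by [P]. *)
Lemma four_functions_two_points (R : realFieldType)
    (a0 a1 b0 b1 c0 c1 d0 d1 : R) :
  0 <= a0 -> 0 <= a1 -> 0 <= b0 -> 0 <= b1 ->
  0 <= c0 -> 0 <= c1 -> 0 <= d0 -> 0 <= d1 ->
  a0 * b0 <= c0 * d0 -> a0 * b1 <= c1 * d0 -> a1 * b0 <= c1 * d0 ->
  a1 * b1 <= c1 * d1 ->
  (a0 + a1) * (b0 + b1) <= (c0 + c1) * (d0 + d1).
Proof.
move=> a0p a1p b0p b1p c0p c1p d0p d1p h00 h01 h10 h11.
have c01 : 0 <= c0 * d1 by exact: mulr_ge0.
have := mulr_ge0 c1p d0p; rewrite le_eqVlt => /orP[/eqP P0|P0].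
  rewrite -P0 in h01 h10; nra.
have uv : (a0 * b1) * (a1 * b0) <= (c0 * d1) * (c1 * d0).
  have -> : (a0 * b1) * (a1 * b0) = (a0 * b0) * (a1 * b1) by ring.
  have -> : (c0 * d1) * (c1 * d0) = (c0 * d0) * (c1 * d1) by ring.
  by apply: ler_pM => //; exact: mulr_ge0.
rewrite -(ler_pM2r P0).
have q : 0 <= (c1 * d0 - a0 * b1) * (c1 * d0 - a1 * b0).
  by rewrite mulr_ge0// subr_ge0.
have t0 : 0 <= (c0 * d0 - a0 * b0) * (c1 * d0).
  by rewrite mulr_ge0 ?subr_ge0// ltW.
have t1 : 0 <= (c1 * d1 - a1 * b1) * (c1 * d0).
  by rewrite mulr_ge0 ?subr_ge0// ltW.
nra.
Qed.

(* Ahlswede and Daykin *)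
Lemma four_functions (K : choiceType) (R : realFieldType) (E : {fset K})
    (f1 f2 g1 g2 : {fset K} -> R) :
  (forall A, 0 <= f1 A) -> (forall A, 0 <= f2 A) ->
  (forall A, 0 <= g1 A) -> (forall A, 0 <= g2 A) ->
  (forall A B, A `<=` E -> B `<=` E ->
    f1 A * f2 B <= g1 (A `|` B) * g2 (A `&` B)) ->
  (\sum_(A <- fpowerset E) f1 A) * (\sum_(A <- fpowerset E) f2 A)
  <= (\sum_(A <- fpowerset E) g1 A) * (\sum_(A <- fpowerset E) g2 A).
Proof.
elim/fset_ind1U: E f1 f2 g1 g2 => [|e E eE IH] f1 f2 g1 g2 f1p f2p g1p g2p H.
  rewrite fpowerset0 !big_seq_fset1.
  by have := H fset0 fset0; rewrite fsetU0 fsetI0; exact.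
rewrite !big_fpowersetU1//; apply: IH => [A|A|A|A|A B AE BE]; try exact: addr_ge0.
have eA : e \notin A by apply: contra eE; move/fsubsetP: AE; exact.
have eB : e \notin B by apply: contra eE; move/fsubsetP: BE; exact.
have sub C : C `<=` E -> C `<=` e |` E.
  by move=> CE; rewrite (fsubset_trans CE)// fsubsetUr.
have subU C : C `<=` E -> e |` C `<=` e |` E by exact: fsetUS.
apply: four_functions_two_points => //.
- by apply: H; exact: sub.
- have := H A (e |` B) (sub _ AE) (subU _ BE).
  rewrite fsetUCA; have -> // : A `&` (e |` B) = A `&` B.
  apply/fsetP => z; rewrite !inE; have [->|//] := eqVneq z e.
  by rewrite (negPf eA).
- have := H (e |` A) B (subU _ AE) (sub _ BE).
  rewrite -fsetUA; have -> // : (e |` A) `&` B = A `&` B.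
  apply/fsetP => z; rewrite !inE; have [->|//] := eqVneq z e.
  by rewrite (negPf eB) !andbF.
- have := H (e |` A) (e |` B) (subU _ AE) (subU _ BE).
  by rewrite -fsetUIr -fsetUUr.
Qed.

(** Four functions with the indicator of [Q] attached to [m2] on the left and to [m1] on the right:
    as [Q] is increasing, [Q B] implies that it holds for the union. The products replace quotients,
    so no normalisation is required. *)
Lemma holley (K : choiceType) (R : realFieldType) (E : {fset K})
    (m1 m2 : {fset K} -> R) (Q : pred {fset K}) :
  (forall A, 0 <= m1 A) -> (forall A, 0 <= m2 A) ->
  (forall A B, A `<=` B -> Q A -> Q B) ->
  (forall A B, A `<=` E -> B `<=` E ->
    m1 A * m2 B <= m1 (A `|` B) * m2 (A `&` B)) ->
  (\sum_(A <- fpowerset E) m1 A) * (\sum_(A <- fpowerset E | Q A) m2 A)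
  <= (\sum_(A <- fpowerset E | Q A) m1 A) * (\sum_(A <- fpowerset E) m2 A).
Proof.
move=> m1p m2p Qmono H.
rewrite [X in _ * X <= _]big_mkcond [X in _ <= X * _]big_mkcond.
apply: four_functions => // [A|A|A B AE BE]; try by case: ifP.
case: ifP => [QB|_]; last by rewrite mulr0 mulr_ge0//; case: ifP.
by rewrite (Qmono B)// ?fsubsetUr// H.
Qed.

(** * Component counts of nested relations *)

Section NComp.
Variables (T : finType) (r r' : rel T).
Local Notation root := fingraph.root.
Hypotheses (symr : symmetric r) (symr' : symmetric r') (sub : subrel r r').

Let sub_connect_r : subrel (connect r) (connect r').
Proof. by apply: connect_sub => u v /sub; exact: connect1. Qed.

Let root_inj : {in roots r' &, injective (root r)}.
Proof.
have cr := sym_connect_sym symr; have cr' := sym_connect_sym symr'.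
move=> u v /eqP ru /eqP rv /eqP; rewrite root_connect// => /sub_connect_r.
by rewrite -(root_connect cr') ru rv => /eqP.
Qed.

(** [root r] maps the roots of [r'] injectively to roots of [r]. *)
Lemma n_comp_subrel : (n_comp r' predT <= n_comp r predT)%N.
Proof.
have cr := sym_connect_sym symr.
rewrite /n_comp_mem -(card_in_image (f := root r)); last first.
  by move=> u v; rewrite !inE !andbT; exact: root_inj.
apply: subset_leq_card; apply/fintype.subsetP => z /fintype.imageP[u _ ->].
by rewrite !inE andbT; exact: roots_root.
Qed.

Lemma n_comp_subrel_lt u v : r' u v -> ~~ connect r u v ->
  (n_comp r' predT < n_comp r predT)%N.
Proof.
have cr := sym_connect_sym symr; have cr' := sym_connect_sym symr'.
move=> uv nuv.
rewrite /n_comp_mem -(card_in_image (f := root r)); last first.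
  by move=> a b; rewrite !inE !andbT; exact: root_inj.
apply: proper_card; apply/fintype.properP; split.
  apply/fintype.subsetP => z /fintype.imageP[a _ ->].
  by rewrite !inE andbT; exact: roots_root.
have ruv : root r u != root r v by rewrite root_connect.
have r'uv : root r' u = root r' v by apply/eqP; rewrite root_connect// connect1.
(* A root of [r] in the image must come from the [r']-root of its own class; [u] and [v] share that
   class, so one of their two [r]-roots is missed. *)
have im z : root r z \in fintype.image (root r) (predI (roots r') predT) ->
    root r z = root r (root r' z).
  case/fintype.imageP => a; rewrite !inE andbT => /eqP ra e; rewrite e; congr root.
  rewrite -ra; apply/esym/eqP; rewrite root_connect//.
  by apply: sub_connect_r; rewrite -root_connect//; apply/eqP.
have mem z : root r z \in predI (roots r) predT.
  by rewrite !inE andbT; exact: roots_root.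
have [iu|niu] := boolP (root r u \in fintype.image (root r) (predI (roots r') predT)).
  exists (root r v) => //; apply: contra ruv => iv.
  by rewrite (im _ iu) (im _ iv) r'uv.
by exists (root r u).
Qed.

End NComp.

(** * Wired connectivity in a domain *)

Section Domain.
Variables (V : countType) (adj : rel V).
Variables (VD : {fset V}) (ED : {fset edge adj}).

Lemma joinsC (e : edge adj) u v : joins e u v = joins e v u.
Proof. by rewrite /joins orbC. Qed.

Lemma linkE_sym (w : {fset edge adj}) : symmetric (linkE w).
Proof. by move=> u v; apply: eq_has => e; rewrite joinsC. Qed.

Lemma linkE_sub (w w' : {fset edge adj}) u v :
  w `<=` w' -> linkE w u v -> linkE w' u v.
Proof.
by move=> /fsubsetP sub /hasP[e ew j]; apply/hasP; exists e => //; exact: sub.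
Qed.

Lemma joins_incident (e : edge adj) u v :
  joins e u v -> incident u e /\ incident v e.
Proof. by rewrite /incident => /orP[] /andP[-> ->]; rewrite orbT. Qed.

Lemma joins_efst_esnd (e : edge adj) : joins e (efst e) (esnd e).
Proof. by rewrite /joins !eqxx. Qed.

Local Notation wrel := (@wired_rel V adj VD ED).

Lemma wired_rel_sym w : symmetric (wrel w).
Proof. by move=> u v; rewrite /wired_rel linkE_sym andbC. Qed.

Lemma wired_connect_sym w : connect_sym (wrel w).
Proof. exact: sym_connect_sym (wired_rel_sym w). Qed.

Lemma wired_rel_sub w w' : w `<=` w' -> subrel (wrel w) (wrel w').
Proof.
move=> ww' u v /orP[l|b]; apply/orP; last by right.
by left; exact: linkE_sub l.
Qed.

Lemma wired_connect_sub w w' :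
  w `<=` w' -> subrel (connect (wrel w)) (connect (wrel w')).
Proof. by move=> ww'; apply: connect_sub => u v /(wired_rel_sub ww') /connect1. Qed.

Lemma bdry_out (u : VD) (e : edge adj) :
  incident (val u) e -> e \notin ED -> bdry VD ED (val u).
Proof. by move=> ie eE; split; [exact: valP|exists e]. Qed.

(* Edges outside the domain only join boundary vertices, which are wired. *)
Lemma wired_relI w : wrel (w `&` ED) =2 wrel w.
Proof.
move=> u v; apply/idP/idP; first by apply: wired_rel_sub; exact: fsubsetIl.
case/orP => [/hasP[e ew j]|b]; apply/orP; last by right.
have [eE|eE] := boolP (e \in ED).
  by left; apply/hasP; exists e => //; rewrite inE ew.
have [iu iv] := joins_incident j.
by right; apply/andP; split; apply/asboolP; apply: bdry_out eE.
Qed.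

Definition bconn (w : {fset edge adj}) (z : VD) : bool :=
  [exists b : VD, `[< bdry VD ED (val b) >] && connect (wrel w) z b].

Lemma bconn_sub w w' z : w `<=` w' -> bconn w z -> bconn w' z.
Proof.
move=> ww' /existsP[b /andP[bb zb]]; apply/existsP; exists b.
by rewrite bb /=; exact: wired_connect_sub zb.
Qed.

(** Makes [bconn] an event of the edges of the domain alone, which is what allows its decomposition
    into cylinders over [ED]. *)
Lemma bconnI w z : bconn (w `&` ED) z = bconn w z.
Proof.
by apply: eq_existsb => b; rewrite (eq_connect (wired_relI w)).
Qed.

Lemma bconn_connect w y z : bconn w y -> connect (wrel w) y z -> bconn w z.
Proof.
move=> /existsP[b /andP[bb yb]] yz; apply/existsP; exists b; rewrite bb /=.
by apply: connect_trans yb; rewrite wired_connect_sym.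
Qed.

Lemma bconn2_connect w y z : bconn w y -> bconn w z -> connect (wrel w) y z.
Proof.
move=> /existsP[b /andP[bb yb]] /existsP[b' /andP[bb' zb']].
apply: connect_trans yb _; rewrite wired_connect_sym.
by apply: connect_trans zb' _; apply: connect1; apply/orP; right; rewrite bb'.
Qed.

Section Compare.
Variables (Vn : {fset V}) (En : {fset edge adj}).
Hypotheses (sV : VD `<=` Vn) (sE : ED `<=` En).
Hypothesis (subD : is_subgraph VD ED).

Local Notation wreln := (@wired_rel V adj Vn En).

(* A path of the larger domain that leaves the smaller one does so, and comes
   back, through its wired boundary. *)
Lemma wired_connect_restrict (k w : {fset edge adj}) (u v : VD) (u' v' : Vn) :
  k `&` ED `<=` w -> val u' = val u -> val v' = val v ->
  connect (wreln k) u' v' -> connect (wrel w) u v.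
Proof.
move=> kw eu ev /connectP[p].
(* Invariant along the path: a vertex of the domain is already connected to [u] there, and once the
   path is outside, [u] has reached the wired boundary. *)
pose P (t : Vn) := (forall t' : VD, val t' = val t -> connect (wrel w) u t') /\
  (val t \notin VD -> bconn w u).
have step s t : P s -> wreln k s t -> P t.
  move=> [Ps Psn] st.
  have key (z : VD) (bz : bdry VD ED (val z)) : bconn w u ->
      connect (wrel w) u z.
    move=> bu; apply: bconn2_connect => //; apply/existsP; exists z.
    by rewrite connect0 andbT; apply/asboolP.
  have bs : (val s \in VD -> bdry VD ED (val s)) -> bconn w u.
    have [sD|sD] := boolP (val s \in VD); last by move=> _; exact: Psn.
    move=> /(_ isT) b; apply/existsP; exists [` sD]; rewrite Ps// andbT.
    exact/asboolP.
  have out : (val s \in VD -> bdry VD ED (val s)) ->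
      (val t \in VD -> bdry VD ED (val t)) -> P t.
    move=> hs ht; split => [t' tt'|_]; last exact: bs.
    by apply: key; [rewrite tt'; apply: ht; rewrite -tt'; exact: valP|exact: bs].
  case/orP: st => [/hasP[e ek j]|/andP[/asboolP bs' /asboolP bt']].
    have [eE|eE] := boolP (e \in ED).
      have [sD tD] : val s \in VD /\ val t \in VD.
        have /andP[e1 e2] := subD eE.
        by case/orP: j => /andP[/eqP <- /eqP <-].
      split; last by rewrite tD.
      move=> t' tt'; apply: connect_trans (Ps [` sD] _) _ => //.
      apply: connect1; apply/orP; left; apply/hasP; exists e.
        by move/fsubsetP: kw; apply; rewrite inE ek.
      by rewrite tt'.
    have [is' it] := joins_incident j.
    by apply: out => h; split => //; exists e.
  (* An edge missing from [En] is missing from [ED], so wiring in the larger volume only affects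
     boundary vertices of the smaller one. *)
  have bn z : bdry Vn En z -> z \in VD -> bdry VD ED z.
    move=> [_ [e [eE ie]]] zD; split => //; exists e; split => //.
    by apply: contra eE; move/fsubsetP: sE; exact.
  by apply: out; exact: bn.
have Pu : P u'.
  split=> [t' /esym|]; last by rewrite eu (valP u).
  by rewrite eu => /val_inj <-; exact: connect0.
have : forall p s, P s -> path (wreln k) s p -> P (last s p).
  by elim=> //= t q IH s Ps /andP[st]; apply: IH; exact: step st.
move=> /(_ p u' Pu) H /H{}H lst; move: H; rewrite -lst => -[+ _].
by apply; rewrite ev.
Qed.

Lemma wired_ncomp_sub (k k' : {fset edge adj}) :
  k `<=` k' -> (wired_ncomp Vn En k' <= wired_ncomp Vn En k)%N.
Proof.
move=> kk'; rewrite /wired_ncomp; apply: n_comp_subrel.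
- by move=> u v; rewrite /wired_rel linkE_sym andbC.
- by move=> u v; rewrite /wired_rel linkE_sym andbC.
- by move=> u v /orP[l|b]; apply/orP; [left; exact: linkE_sub l|right].
Qed.

(** By [wired_connect_restrict], vertices separated by [w] in the domain are separated by [k] in the
    larger volume, so opening [e] merges two components there. *)
Lemma wired_ncomp_lt (k w : {fset edge adj}) (e : edge adj) (u v : VD) :
  k `&` ED `<=` w -> joins e (val u) (val v) ->
  ~~ connect (wrel w) u v ->
  (wired_ncomp Vn En (e |` k) < wired_ncomp Vn En k)%N.
Proof.
move=> kw j nuv; rewrite /wired_ncomp.
have uV : val u \in Vn by move/fsubsetP: sV; apply; exact: valP.
have vV : val v \in Vn by move/fsubsetP: sV; apply; exact: valP.
apply: (@n_comp_subrel_lt _ _ _ _ _ _ [` uV] [` vV]).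
- by move=> a b; rewrite /wired_rel linkE_sym andbC.
- by move=> a b; rewrite /wired_rel linkE_sym andbC.
- move=> a b /orP[l|b']; apply/orP; [left; apply: linkE_sub l|by right].
  exact: fsubsetUr.
- by apply/orP; left; apply/hasP; exists e => //; rewrite !inE eqxx.
- by apply: contra nuv; exact: wired_connect_restrict.
Qed.

End Compare.

End Domain.

(** * Heights with a given absolute value *)

Lemma in_fset_filter (K : choiceType) (A : {fset K}) (P : pred K) x :
  (x \in [fset y in A | P y]) = (x \in A) && P x.
Proof. by rewrite !inE. Qed.

Lemma card_fset_filter (K : choiceType) (A : {fset K}) (P : pred K) :
  #|` A| = (#|` [fset x in A | P x]| + #|` [fset x in A | ~~ P x]|)%N.
Proof.
rewrite -[LHS](cardfsID [fset x in A | P x]).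
congr addn; congr #|` _|; apply/fsetP => x; rewrite !inE.
  by rewrite andbA andbb.
by case: (x \in A); rewrite ?andbT ?andbF.
Qed.

Section Heights.
Variables (V : countType) (adj : rel V).
Variables (VD : {fset V}) (ED : {fset edge adj}).
Hypothesis subD : is_subgraph VD ED.
Hypothesis finH : finite_set (heights VD ED).

Local Notation wrel := (@wired_rel V adj VD ED).

Definition hset : {fset (V -> int)} := fset_set (heights VD ED).

Lemma in_hset h : (h \in hset) = `[< height_fun VD ED h >].
Proof. by rewrite in_fset_set. Qed.

Definition habs (h : V -> int) : V -> int := fun v => `|h v|.

Definition agree (w : {fset edge adj}) (h : V -> int) : bool :=
  all (fun e => (0 < h (efst e)) == (0 < h (esnd e))) (w `&` ED).

Definition fiber (a : V -> int) (w : {fset edge adj}) : {fset (V -> int)} :=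
  [fset h in hset | (habs h == a) && agree w h].

Lemma in_fiber a w h :
  (h \in fiber a w) = [&& h \in hset, habs h == a & agree w h].
Proof. by rewrite !inE. Qed.

Lemma agreeP w h :
  reflect (forall e, e \in w -> e \in ED ->
    (0 < h (efst e)) = (0 < h (esnd e))) (agree w h).
Proof.
apply: (iffP allP) => H e.
  by move=> ew eE; apply/eqP; apply: H; rewrite inE ew.
by rewrite inE => /andP[ew eE]; apply/eqP; exact: H.
Qed.

Lemma height_neq0 h v : height_fun VD ED h -> h v != 0.
Proof.
move=> [h1 [h2 _]]; have [/h2[k ->]|/h1 ->//] := boolP (v \in VD).
lia.
Qed.

Lemma height_habs h : height_fun VD ED h -> height_fun VD ED (habs h).
Proof.
move=> [h1 [h2 [h3 h4]]]; split; [|split; [|split]].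
- by move=> v /h1 hv; rewrite /habs hv.
- move=> v /h2[k hk]; rewrite /habs hk; have [k0|k0] := leP 0 k.
    by exists k; lia.
  by exists (- k - 1); lia.
- by move=> e /h3; rewrite /habs; lia.
- by move=> v /h4 hv; rewrite /habs hv.
Qed.

(** The all-positive representative satisfies every sign constraint, so no fibre over an attained
    absolute value is empty. *)
Lemma fiber_habs w h : height_fun VD ED h -> habs h \in fiber (habs h) w.
Proof.
move=> hh; rewrite in_fiber in_hset; apply/and3P; split.
- by apply/asboolP; exact: height_habs.
- by apply/eqP/funext => v; rewrite /habs normr_id.
- by apply/agreeP => e _ _; rewrite /habs !normr_gt0 !height_neq0.
Qed.

Lemma fiber_sign a w h (u v : VD) : h \in fiber a w ->
  connect (wrel w) u v -> (0 < h (val u)) = (0 < h (val v)).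
Proof.
rewrite in_fiber in_hset => /and3P[/asboolP[_ [_ [_ hb]]] _ /agreeP ag].
case/connectP => p; elim: p u => [|t p IH] u /=; first by move=> _ ->.
case/andP => ut pt /(IH _ pt) <-.
have bb s s' : bdry VD ED s -> bdry VD ED s' -> (0 < h s) = (0 < h s').
  by move=> /hb -> /hb ->.
case/orP: ut => [/hasP[e ew j]|/andP[/asboolP bu /asboolP bt]]; last exact: bb.
have [eE|eE] := boolP (e \in ED).
  have := ag _ ew eE.
  by case/orP: j => /andP[/eqP <- /eqP <-].
have [iu iv] := joins_incident j.
by apply: bb; exact: bdry_out eE.
Qed.

Lemma fiber_bconn a w h (z : VD) : h \in fiber a w -> bconn ED w z ->
  0 < h (val z).
Proof.
move=> hf /existsP[b /andP[/asboolP bb zb]]; rewrite (fiber_sign hf zb).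
move: hf; rewrite in_fiber in_hset => /and3P[/asboolP[_ [_ [_ hb]]] _ _].
by rewrite hb.
Qed.

(* Conditionally on the absolute value [a] of the heights, the sign changes
   only across edges both of whose endpoints have absolute value 1. *)
Definition soft (a : V -> int) (e : edge adj) : bool :=
  (a (efst e) == 1) && (a (esnd e) == 1).

Definition rigid (a : V -> int) (w : {fset edge adj}) : Prop :=
  forall e, e \in ED -> e \notin w -> soft a e.

(** [connect] lives on the finite type [VD]; [insub] leaves vertices outside the domain at their
    fixed value. *)
Definition flip (w : {fset edge adj}) (z : VD) (h : V -> int) : V -> int :=
  fun v => if insub v is Some v' then
             if connect (wrel w) z v' then - h v else h v
           else h v.

Lemma flipK w z : involutive (flip w z).
Proof.
move=> h; apply/funext => v; rewrite /flip; case: insub => // v'.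
by case: (connect _ _ _); rewrite ?opprK.
Qed.

Lemma flipE w z h (v : VD) :
  flip w z h (val v) = if connect (wrel w) z v then - h (val v) else h (val v).
Proof. by rewrite /flip valK. Qed.

Lemma habs_flip w z h : habs (flip w z h) = habs h.
Proof.
apply/funext => v; rewrite /habs /flip; case: insub => // v'.
by case: ifP; rewrite ?normrN.
Qed.

(** The two ends of an open edge flip together; a closed edge is soft, hence tolerates any pair of
    signs; and the flipped component contains no boundary vertex. *)
Lemma flip_fiber a w z h : rigid a w -> ~~ bconn ED w z ->
  h \in fiber a w -> flip w z h \in fiber a w.
Proof.
move=> ra nz; rewrite !in_fiber habs_flip !in_hset => /and3P[/asboolP hh ha ag].
rewrite ha; move: (hh) => [h1 [h2 [h3 h4]]].
have endp e (eE : e \in ED) : exists u v : VD, val u = efst e /\ val v = esnd e.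
  by have /andP[e1 e2] := subD eE; exists [` e1], [` e2].
have both e u v : e \in w -> val u = efst e -> val v = esnd e ->
    connect (wrel w) z u = connect (wrel w) z v.
  move=> ew eu ev; apply: same_connect_r; first exact: wired_connect_sym.
  apply: connect1; apply/orP; left; apply/hasP; exists e => //.
  by rewrite eu ev joins_efst_esnd.
apply/andP; split; last first.
  apply/agreeP => e ew eE; have [u [v [eu ev]]] := endp _ eE.
  rewrite -eu -ev !flipE (both _ _ _ ew eu ev); move/agreeP: ag => /(_ _ ew eE).
  have := height_neq0 (val u) hh; have := height_neq0 (val v) hh.
  by rewrite eu ev; case: ifP; lia.
apply/asboolP; split; [|split; [|split]].
- move=> v vD; rewrite /flip; case: insubP => [v' v'D _|_]; last exact: h1.
  by rewrite v'D in vD.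
- move=> v vD; have [k hk] := h2 _ vD; rewrite -[v]/(val [` vD]) flipE /= hk.
  by case: ifP => _; [exists (- k - 1); lia|exists k].
- move=> e eE; have [u [v [eu ev]]] := endp _ eE.
  have := h3 _ eE; rewrite -eu -ev !flipE.
  have [ew|ew] := boolP (e \in w).
    by rewrite (both _ _ _ ew eu ev); case: ifP; lia.
  have /andP[] := ra _ eE ew; rewrite -(eqP ha) /habs -eu -ev.
  by case: ifP; case: ifP; lia.
- move=> v bv; have vD : v \in VD by case: bv.
  rewrite -[v]/(val [` vD]) flipE /= h4//.
  case: ifP => // zv; case/negP: nz; apply/existsP; exists [` vD].
  by rewrite zv andbT; exact/asboolP.
Qed.

(** For rigid [w] and [a] the absolute value of a height, this is 2 to the number of components not
    wired to the boundary: the FK cluster factor of the sign model. *)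
Definition Nfib a w := #|` fiber a w|.

Lemma leq_card_flip a w z (P Q : pred (V -> int)) :
  rigid a w -> ~~ bconn ED w z ->
  (forall h, h \in fiber a w -> P h -> Q (flip w z h)) ->
  (#|` [fset h in fiber a w | P h]| <= #|` [fset h in fiber a w | Q h]|)%N.
Proof.
move=> ra nz PQ.
have -> : #|` [fset h in fiber a w | P h]|
    = #|` [fset flip w z h | h in [fset h in fiber a w | P h]]|.
  by rewrite [RHS]card_imfset//; exact: inv_inj (flipK w z).
apply: fsubset_leq_card; apply/fsubsetP => g /imfsetP[h /=].
rewrite in_fset_filter => /andP[hf Ph] ->.
by rewrite in_fset_filter PQ// andbT; exact: flip_fiber.
Qed.

Lemma Nfib_gt0 w h : height_fun VD ED h -> (0 < Nfib (habs h) w)%N.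
Proof.
move=> hh; rewrite cardfs_gt0; apply/fset0Pn; exists (habs h).
exact: fiber_habs.
Qed.

Lemma fiberU1 a w e : e \in ED -> fiber a (e |` w) =
  [fset h in fiber a w | (0 < h (efst e)) == (0 < h (esnd e))].
Proof.
move=> eE; apply/fsetP => h; rewrite in_fset_filter !in_fiber.
case: (h \in hset); case: (habs h == a) => //=.
apply/agreeP/andP => [ag|[/agreeP ag /eqP he] e'].
  split; last by apply/eqP; apply: ag => //; rewrite !inE eqxx.
  by apply/agreeP => e' e'w; apply: ag; rewrite !inE e'w orbT.
by rewrite !inE => /orP[/eqP ->//|]; exact: ag.
Qed.

Lemma Nfib_connect a w e (u v : VD) : e \in ED ->
  val u = efst e -> val v = esnd e ->
  connect (wrel w) u v -> (Nfib a w <= Nfib a (e |` w))%N.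
Proof.
move=> eE eu ev uv; apply: fsubset_leq_card; apply/fsubsetP => h hf.
by rewrite fiberU1// in_fset_filter hf/= -eu -ev (fiber_sign hf uv).
Qed.

(** If the ends of [e] are in different components, one of these avoids the boundary; flipping it
    injects the heights that disagree across [e] into those that agree. *)
Lemma Nfib_halve a w e : e \in ED -> rigid a w ->
  (Nfib a w <= 2 * Nfib a (e |` w))%N.
Proof.
move=> eE ra; have /andP[e1 e2] := subD eE.
pose u : VD := [` e1]; pose v : VD := [` e2].
have [uv|nuv] := boolP (connect (wrel w) u v).
  apply: leq_trans (leq_pmull _ _) => //.
  exact: (@Nfib_connect a w e u v eE erefl erefl uv).
have [z [zuv nz]] : exists z, (z = u \/ z = v) /\ ~~ bconn ED w z.
  have [bu|nu] := boolP (bconn ED w u); last by exists u; split; [left|].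
  exists v; split; [by right|]; apply: contra nuv; exact: bconn2_connect.
pose P (h : V -> int) := (0 < h (efst e)) == (0 < h (esnd e)).
rewrite /Nfib (card_fset_filter _ P) fiberU1// mul2n -addnn leq_add2l.
apply: leq_card_flip nz _ => // h; rewrite in_fiber in_hset.
case/and3P => /asboolP hh _ _; rewrite /P -[efst e]/(val u) -[esnd e]/(val v).
rewrite !flipE; have := height_neq0 (val u) hh; have := height_neq0 (val v) hh.
have : connect (wrel w) z u != connect (wrel w) z v.
  case: zuv => ->; rewrite connect0 ?(negPf nuv)//.
  by rewrite wired_connect_sym (negPf nuv).
by do 2 case: ifP; lia.
Qed.

End Heights.

(** * Comparison with a larger volume *)

Section Comparison.
Variables (V : countType) (adj : rel V) (R : realType) (c : edge adj -> R).
Variables (VD Vn : {fset V}) (ED En : {fset edge adj}).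
Hypothesis c_ge1 : forall e, 1 <= c e.
Hypothesis subD : is_subgraph VD ED.
Hypothesis finH : finite_set (heights VD ED).
Hypotheses (sV : VD `<=` Vn) (sE : ED `<=` En).

Local Notation Nf := (@Nfib V adj VD ED).
Local Notation ncomp := (wired_ncomp Vn En).

Lemma rigidS a w w' : w `<=` w' -> rigid ED a w -> rigid ED a w'.
Proof.
move=> /fsubsetP ww' ra e eE ew'; apply: ra => //.
by apply: contra ew'; exact: ww'.
Qed.

(** Either the ends of [e] are connected by [w], and opening [e] costs no height, or the cost is at
    most a factor 2, which is paid for by the lost component of the larger volume. *)
Lemma Nfib_ncomp_step a w k e : e \in ED -> k `&` ED `<=` w -> rigid ED a w ->
  (Nf a w * 2 ^ ncomp (e |` k) <= Nf a (e |` w) * 2 ^ ncomp k)%N.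
Proof.
move=> eE kw ra; have /andP[e1 e2] := subD eE.
pose u : VD := [` e1]; pose v : VD := [` e2].
have [uv|nuv] := boolP (connect (@wired_rel V adj VD ED w) u v).
  apply: leq_mul; first apply: (Nfib_connect _ _ _ _ _ uv) => //.
  have le := wired_ncomp_sub Vn En (fsubsetUr [fset e] k).
  have lt0 : (0 < 2)%N by [].
  exact (leq_pexp2l lt0 le).
have lt : (ncomp (e |` k) < ncomp k)%N.
  by apply: (wired_ncomp_lt sV sE subD kw _ nuv); exact: joins_efst_esnd.
apply: leq_trans (leq_mul (Nfib_halve subD finH eE ra) (leqnn _)) _.
by rewrite mulnAC mulnC -expnS leq_mul2l leq_exp2l// lt orbT.
Qed.

Lemma Nfib_ncomp a w k F : (forall w, 0 < Nf a w)%N ->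
  F `<=` ED -> k `&` ED `<=` w -> rigid ED a w ->
  (Nf a w * 2 ^ ncomp (F `|` k) <= Nf a (F `|` w) * 2 ^ ncomp k)%N.
Proof.
move=> N0 + kw ra; elim/fset_ind1U: F => [|e F eF IH] FE.
  by rewrite !fset0U.
have [eE FE'] : e \in ED /\ F `<=` ED.
  by move: FE; rewrite fsubUset fsub1set => /andP.
have step : (Nf a (F `|` w) * 2 ^ ncomp (e |` (F `|` k)) <=
    Nf a (e |` (F `|` w)) * 2 ^ ncomp (F `|` k))%N.
  apply: Nfib_ncomp_step => //; last by apply: rigidS ra; exact: fsubsetUr.
  apply/fsubsetP => z; rewrite !inE andb_orl => /orP[/andP[-> _]//|].
  by rewrite -in_fsetI => zk; apply/orP; right; move/fsubsetP: kw; exact.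
rewrite -!fsetUA.
(* Telescoping without division: the positive middle factor [y * q] is cancelled. *)
have chain (x y z p q r : nat) : (0 < y * q)%N ->
    (x * q <= y * p)%N -> (y * r <= z * q)%N -> (x * r <= z * p)%N.
  move=> yq xy yz; rewrite -(leq_pmul2r yq).
  by have := leq_mul xy yz; congr (_ <= _)%N; ring.
by apply: chain (IH FE') step; rewrite muln_gt0 N0 expn_gt0.
Qed.

(* Expanding the product of [open_weight * 1{equal signs} + closed_weight] over
   the edges of the larger volume gives the weight of [h] on its domain: the
   edges outside the domain are deterministically open. *)
Definition open_weight (a : V -> int) (e : edge adj) : R :=
  if e \in ED then
    if soft a e then c e - 1
    else if a (efst e) == a (esnd e) then c e else 1
  else 1.

Definition closed_weight (a : V -> int) (e : edge adj) : R :=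
  if (e \in ED) && soft a e then 1 else 0.

Definition config_weight (a : V -> int) (w : {fset edge adj}) : R :=
  \prod_(e <- En) (if e \in w then open_weight a e else closed_weight a e).

Lemma open_weight_ge0 a e : 0 <= open_weight a e.
Proof.
rewrite /open_weight; have := c_ge1 e.
by do 3?case: ifP => //; lra.
Qed.

Lemma closed_weight_ge0 a e : 0 <= closed_weight a e.
Proof. by rewrite /closed_weight; case: ifP. Qed.

Lemma config_weight_ge0 a w : 0 <= config_weight a w.
Proof.
by apply: prodr_ge0 => e _; case: ifP; rewrite (open_weight_ge0, closed_weight_ge0).
Qed.

Lemma config_weight_neq0 a w : config_weight a w != 0 ->
  rigid ED a w /\ forall e, e \in En -> e \notin ED -> e \in w.
Proof.
rewrite prodf_seq_neq0 => /allP H; split=> e eE ew.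
  have /= := H e; rewrite (negPf ew) /closed_weight eE; case: (soft a e) => //.
  by move/fsubsetP: sE => /(_ _ eE) -> /(_ isT); rewrite eqxx.
have /= := H e eE; case: (e \in w) => //.
by rewrite /closed_weight (negPf ew) eqxx.
Qed.

Lemma hweight_expand h : height_fun VD ED h ->
  hweight c ED h =
  \sum_(w <- fpowerset En) config_weight (habs h) w * (agree ED w h)%:R.
Proof.
move=> hh; move: (hh) => [_ [_ [h3 _]]].
pose s e : R := (~~ (e \in ED) || ((0 < h (efst e)) == (0 < h (esnd e))))%:R.
transitivity (\prod_(e <- En) (open_weight (habs h) e * s e + closed_weight (habs h) e)).
  rewrite /hweight -(big_fset_incl _ sE); last first.
    by move=> e _ eE; rewrite /open_weight /closed_weight /s (negPf eE) /= mulr1 addr0.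
  apply: eq_big_seq => e eE; rewrite /open_weight /closed_weight /s eE /= /soft /habs.
  have := h3 _ eE; have := height_neq0 (efst e) hh.
  have := height_neq0 (esnd e) hh.
  move: (h (efst e)) (h (esnd e)) => x y y0 x0 xy.
  have [sgn|sgn] := eqVneq (0 < x) (0 < y).
    have -> : (`|x| == `|y|) = (x == y) by lia.
    have [/andP[x1 y1]|_] := boolP ((`|x| == 1) && (`|y| == 1)); last first.
      by rewrite mulr1 addr0.
    have -> : x == y by lia.
    by rewrite mulr1 subrK.
  (* Nonzero values of opposite signs at distance at most 2 can only be 1 and -1. *)
  have -> : (`|x| == 1) && (`|y| == 1) by lia.
  have -> : (x == y) = false by lia.
  by rewrite mulr0 add0r.
rewrite prod_add_fpowerset; apply: eq_big_seq => w; rewrite fpowersetE => wE.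
rewrite /config_weight; have [/agreeP ag|nag] := boolP (agree ED w h).
  rewrite mulr1; apply: eq_bigr => e _; case: ifP => // ew.
  rewrite /s; have [eE|eE] := boolP (e \in ED); last by rewrite mulr1.
  by rewrite ag// eqxx mulr1.
rewrite mulr0; move: nag; rewrite -has_predC => /hasP[e].
rewrite inE => /andP[ew eE] /= ne.
rewrite (big_fsetD1 e) /=; last by move/fsubsetP: sE; exact.
by rewrite ew /s eE (negPf ne) /= mulr0 mul0r.
Qed.

Lemma agree_sum a w (F : (V -> int) -> R) :
  \sum_(h <- hset VD ED | habs h == a) F h * (agree ED w h)%:R
  = \sum_(h <- fiber VD ED a w) F h.
Proof.
rewrite /fiber -big_fset_condE [RHS]big_mkcondr /=; apply: eq_bigr => h _.
by case: agree; rewrite ?mulr1 ?mulr0.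
Qed.

Lemma hweight_fiber_sum a (F : (V -> int) -> R) :
  \sum_(h <- hset VD ED | habs h == a) hweight c ED h * F h
  = \sum_(w <- fpowerset En) config_weight a w * \sum_(h <- fiber VD ED a w) F h.
Proof.
under [RHS]eq_bigr => w _ do rewrite -agree_sum mulr_sumr.
rewrite exchange_big /= big_seq_cond [RHS]big_seq_cond; apply: eq_bigr => h.
rewrite in_hset// => /andP[/asboolP hh /eqP ha].
rewrite hweight_expand// mulr_suml; apply: eq_bigr => w _.
by rewrite ha -mulrA; congr (_ * _); rewrite mulrC.
Qed.

(** A component reaching the boundary has positive sign throughout the fibre. Otherwise flipping the
    component of [z] injects the negative heights into the positive ones, so the sum is at least
    0. *)
Lemma sum_fiber_sg a w (z : VD) : rigid ED a w ->
  (if bconn ED w z then (Nf a w)%:R else 0)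
    <= \sum_(h <- fiber VD ED a w) (Num.sg (h (val z)))%:~R :> R.
Proof.
move=> ra.
have fh h : h \in fiber VD ED a w -> h (val z) != 0.
  by rewrite in_fiber in_hset// => /and3P[/asboolP hh _ _]; exact: height_neq0 hh.
case: ifPn => [bz|nz].
  rewrite /Nfib -sum1_size natr_sum big_seq [leRHS]big_seq.
  by apply: ler_sum => h hf; rewrite gtr0_sg//; exact: fiber_bconn hf bz.
rewrite (big_fsetIDcond _ (fun h => 0 < h (val z))) /=.
have -> : \sum_(h <- [fset h in fiber VD ED a w | 0 < h (val z)])
    (Num.sg (h (val z)))%:~R
    = (#|` [fset h in fiber VD ED a w | 0 < h (val z)]|)%:R :> R.
  rewrite -sum1_size natr_sum big_seq [RHS]big_seq; apply: eq_bigr => h.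
  by rewrite in_fset_filter => /andP[_ h0]; rewrite gtr0_sg.
have -> : \sum_(h <- [fset h in fiber VD ED a w | ~~ (0 < h (val z))])
    (Num.sg (h (val z)))%:~R
    = - (#|` [fset h in fiber VD ED a w | ~~ (0 < h (val z))]|)%:R :> R.
  rewrite -sum1_size natr_sum -sumrN big_seq [RHS]big_seq; apply: eq_bigr => h.
  rewrite in_fset_filter => /andP[/fh hf h0]; rewrite ltr0_sg//.
  by move: hf h0; lia.
rewrite subr_ge0 ler_nat; apply: leq_card_flip nz _ => //.
move=> h /fh hf; rewrite flipE connect0; lia.
Qed.

Lemma pe_bounds e : 0 <= pe c e <= 1.
Proof.
have c1 := c_ge1 e; have c0 : 0 < c e by exact: lt_le_trans c1.
rewrite /pe subr_ge0 invf_le1// c1 /= gerBl invr_ge0.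
exact: ltW.
Qed.

Lemma fk_weight_ge0 w : 0 <= fk_weight c Vn En w.
Proof.
rewrite mulr_ge0 ?exprn_ge0//; apply: prodr_ge0 => e _.
by have /andP[p0 p1] := pe_bounds e; case: ifP; rewrite // subr_ge0.
Qed.

(** On a soft edge both sides equal [1 - 1/c], which is the reason for the choice of [pe]; any other
    edge has closed weight 0. *)
Lemma closed_weight_pe_le a e :
  closed_weight a e * pe c e <= open_weight a e * (1 - pe c e).
Proof.
have /andP[p0 p1] := pe_bounds e; rewrite /closed_weight.
have [/andP[eE sa]|_] := ifP; last by rewrite mul0r mulr_ge0 ?open_weight_ge0 ?subr_ge0.
have c1 := c_ge1 e; have c0 : c e != 0 by rewrite gt_eqF// (lt_le_trans _ c1).
rewrite /open_weight eE sa /pe mul1r opprB addrCA subrr addr0 mulrBl mul1r.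
by rewrite divff.
Qed.

(** The condition splits into an edge product, nontrivial only on the edges of [w'] outside [w], and
    a cluster factor, which is [Nfib_ncomp] applied to opening those edges. They lie in [ED], as a
    configuration of nonzero weight opens all others. *)
Lemma holley_fk a w w' : (forall w, 0 < Nf a w)%N ->
  w `<=` En -> w' `<=` En ->
  config_weight a w * (Nf a w)%:R * fk_weight c Vn En w'
  <= config_weight a (w `|` w') * (Nf a (w `|` w'))%:R *
     fk_weight c Vn En (w `&` w').
Proof.
move=> N0 wE w'E; have [->|nz] := eqVneq (config_weight a w) 0.
  by rewrite !mul0r mulr_ge0 ?fk_weight_ge0// mulr_ge0 ?config_weight_ge0.
have [ra out] := config_weight_neq0 nz.
have FE : w' `\` w `<=` ED.
  apply/fsubsetP => e; rewrite inE => /andP[ew ew'].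
  apply: contraR ew => eE; apply: out => //.
  by move/fsubsetP: w'E; exact.
have kw : (w `&` w') `&` ED `<=` w.
  by rewrite -fsetIA; exact: fsubsetIl.
have := Nfib_ncomp N0 FE kw ra.
have -> : (w' `\` w) `|` (w `&` w') = w'.
  by apply/fsetP => e; rewrite !inE; case: (e \in w); case: (e \in w').
have -> : (w' `\` w) `|` w = w `|` w'.
  by apply/fsetP => e; rewrite !inE; case: (e \in w); case: (e \in w').
move=> Nle.
pose pw (u : {fset edge adj}) : R :=
  \prod_(e <- En) (if e \in u then pe c e else 1 - pe c e).
have prodle : config_weight a w * pw w' <= config_weight a (w `|` w') * pw (w `&` w').
  rewrite /config_weight /pw -!big_split /= big_seq [leRHS]big_seq.
  apply: ler_prod => e _; have /andP[p0 p1] := pe_bounds e.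
  have q0 : 0 <= 1 - pe c e by rewrite subr_ge0.
  rewrite !inE; case: (e \in w); case: (e \in w') => /=;
    rewrite ?lexx ?mulr_ge0 ?open_weight_ge0 ?closed_weight_ge0 ?closed_weight_pe_le//.
have pw0 : 0 <= pw w'.
  apply: prodr_ge0 => e _.
  by have /andP[p0 p1] := pe_bounds e; case: ifP; rewrite // subr_ge0.
rewrite /fk_weight -/(pw w') -/(pw (w `&` w')).
move: prodle (config_weight_ge0 a w) pw0 Nle.
move: (config_weight a w) (config_weight a (w `|` w')) (pw w') (pw (w `&` w')).
move: (Nf a w) (Nf a (w `|` w')) (ncomp w') (ncomp (w `&` w')).
move=> n1 n2 k1 k2 x1 x2 y1 y2 xy x0 y0.
rewrite -(ler_nat R) !natrM !natrX => nk.
have := ler_pM (mulr_ge0 x0 y0) _ xy nk.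
rewrite mulr_ge0 ?exprn_ge0// => /(_ isT).
by rewrite mulrACA (mulrC y1) [x2 * y2 * _]mulrACA (mulrC y2).
Qed.

Lemma sign_fiber_ge a (z : VD) : a \in [fset habs h | h in hset VD ED] ->
  (\sum_(w <- fpowerset En | bconn ED w z) fk_weight c Vn En w) *
    (\sum_(h <- hset VD ED | habs h == a) hweight c ED h)
  <= (\sum_(w <- fpowerset En) fk_weight c Vn En w) *
    (\sum_(h <- hset VD ED | habs h == a)
       hweight c ED h * (Num.sg (h (val z)))%:~R).
Proof.
move=> /imfsetP[h0 /=]; rewrite in_hset// => /asboolP hh0 a0.
have N0 w : (0 < Nf a w)%N by rewrite a0; exact: Nfib_gt0.
pose m1 w := config_weight a w * (Nf a w)%:R.
have m1_ge0 w : 0 <= m1 w by rewrite mulr_ge0 ?config_weight_ge0.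
have -> : \sum_(h <- hset VD ED | habs h == a) hweight c ED h
    = \sum_(w <- fpowerset En) m1 w.
  transitivity (\sum_(h <- hset VD ED | habs h == a) hweight c ED h * 1).
    by apply: eq_bigr => h _; rewrite mulr1.
  rewrite hweight_fiber_sum; apply: eq_bigr => w _; congr (_ * _).
  by rewrite /Nfib -sum1_size natr_sum.
rewrite mulrC hweight_fiber_sum.
apply: le_trans (holley (Q := bconn ED ^~ z) _ _ _ _) _ => //.
- exact: fk_weight_ge0.
- by move=> A B AB; exact: bconn_sub.
- by move=> A B AE BE; exact: holley_fk.
rewrite mulrC; apply: ler_wpM2l.
  by apply: sumr_ge0 => w _; exact: fk_weight_ge0.
rewrite big_mkcond /=; apply: ler_sum => w _.
have [w0|nz] := eqVneq (config_weight a w) 0.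
  by rewrite /m1 w0 !mul0r; case: ifP.
have [ra _] := config_weight_neq0 nz.
apply: le_trans (ler_wpM2l (config_weight_ge0 _ _) (sum_fiber_sg z ra)).
by rewrite /m1; case: ifP; rewrite ?mulr0.
Qed.

(** On each class of heights with common absolute value [a], the cube is the sign times the
    nonnegative constant [t], so [sign_fiber_ge] can be scaled by [t] and summed over [a]. *)
Lemma cube_moment_ge (z : VD) :
  (\sum_(w <- fpowerset En | bconn ED w z) fk_weight c Vn En w) *
    (\sum_(h <- hset VD ED) hweight c ED h * `|(h (val z))%:~R| ^+ 3)
  <= (\sum_(w <- fpowerset En) fk_weight c Vn En w) *
    (\sum_(h <- hset VD ED) hweight c ED h * (h (val z))%:~R ^+ 3).
Proof.
rewrite [X in _ * X <= _](partition_big_imfset _ (@habs V)) /=.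
rewrite [X in _ <= _ * X](partition_big_imfset _ (@habs V)) /= !mulr_sumr.
rewrite big_seq [leRHS]big_seq; apply: ler_sum => a ain.
pose t : R := (a (val z))%:~R ^+ 3.
have t0 : 0 <= t.
  by case/imfsetP: (ain) => h _ ah; rewrite /t ah exprn_ge0// ler0z.
have -> : \sum_(h <- hset VD ED | habs h == a)
      hweight c ED h * `|(h (val z))%:~R| ^+ 3
    = (\sum_(h <- hset VD ED | habs h == a) hweight c ED h) * t.
  rewrite mulr_suml; apply: eq_bigr => h /eqP ha.
  by rewrite /t -ha /habs intr_norm.
have -> : \sum_(h <- hset VD ED | habs h == a)
      hweight c ED h * (h (val z))%:~R ^+ 3
    = (\sum_(h <- hset VD ED | habs h == a)
       hweight c ED h * (Num.sg (h (val z)))%:~R) * t.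
  rewrite mulr_suml big_seq_cond [RHS]big_seq_cond.
  apply: eq_bigr => h; rewrite in_hset// => /andP[/asboolP hh /eqP ha].
  rewrite -mulrA /t -ha /habs; congr (_ * _); rewrite -!rmorphXn -rmorphM /=.
  congr (_%:~R); have := height_neq0 (val z) hh.
  move: (h _) => x x0; rewrite {1}[x]numEsg exprMn; congr (_ * _).
  by move: x0; case: sgrP => // _ _; rewrite ?expr1n// !exprS expr0; ring.
rewrite [leLHS]mulrA [leRHS]mulrA; apply: (ler_wpM2r t0).
exact: (sign_fiber_ge z ain).
Qed.

End Comparison.

(** * Moments of the height *)

Section Moments.
Variables (V : countType) (adj : rel V) (R : realType) (c : edge adj -> R).
Variables (VD : {fset V}) (ED : {fset edge adj}).
Hypothesis c_ge1 : forall e, 1 <= c e.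

Local Notation H := (hset VD ED).

Lemma hweight_ge1 h : 1 <= hweight c ED h.
Proof.
rewrite /hweight; elim/big_rec: _ => // e p _ p1.
apply: (le_trans p1); apply: ler_peMl; first exact: le_trans p1.
by case: ifP.
Qed.

Lemma hweight_ge0 h : 0 <= hweight c ED h.
Proof. exact: le_trans (hweight_ge1 h). Qed.

Section Finite.
Hypothesis finH : finite_set (heights VD ED).

Lemma hE_finite f : hE c VD ED f =
  (\sum_(h <- H) hweight c ED h * f h) / \sum_(h <- H) hweight c ED h.
Proof. by rewrite /hE /hZ !fsbig_finite. Qed.

Lemma hE_le (f : (V -> int) -> R) K : 0 <= K ->
  \sum_(h <- H) hweight c ED h * f h <= K * \sum_(h <- H) hweight c ED h ->
  hE c VD ED f <= K.
Proof.
move=> K0 le; rewrite hE_finite.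
have : 0 <= \sum_(h <- H) hweight c ED h.
  by apply: sumr_ge0 => h _; exact: hweight_ge0.
rewrite le_eqVlt => /orP[/eqP <-|S0]; first by rewrite invr0 mulr0.
by rewrite ler_pdivrMr.
Qed.

Definition reflect1 (h : V -> int) : V -> int := fun v => 2 - h v.

Lemma reflect1K : involutive reflect1.
Proof. by move=> h; apply/funext => v; rewrite /reflect1; ring. Qed.

Lemma height_reflect1 h : height_fun VD ED h -> height_fun VD ED (reflect1 h).
Proof.
move=> [h1 [h2 [h3 h4]]]; rewrite /reflect1; split; [|split; [|split]].
- by move=> v /h1 ->.
- by move=> v /h2[k ->]; exists (- k); ring.
- by move=> e /h3; lia.
- by move=> v /h4 ->.
Qed.

Lemma sum_reflect1 (F : (V -> int) -> R) :
  \sum_(h <- H) hweight c ED h * F h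
  = \sum_(h <- H) hweight c ED h * F (reflect1 h).
Proof.
have HE : H = [fset reflect1 h | h in H].
  apply/fsetP => h; rewrite in_hset//; apply/asboolP/imfsetP => [hh|[g /=]].
    exists (reflect1 h); last by rewrite reflect1K.
    by rewrite /= in_hset//; apply/asboolP; exact: height_reflect1.
  by rewrite in_hset// => /asboolP hg ->; exact: height_reflect1.
rewrite [in LHS]HE big_imfset /=; last by move=> h g _ _; exact: inv_inj reflect1K _ _.
apply: eq_bigr => h _; congr (_ * _); apply: eq_bigr => e _.
by rewrite /reflect1 (inj_eq (addrI _)) (inj_eq oppr_inj).
Qed.

Lemma cube_moment v :
  \sum_(h <- H) hweight c ED h * (h v)%:~R ^+ 3 =
  3 * (\sum_(h <- H) hweight c ED h * (h v)%:~R ^+ 2)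
  - 2 * \sum_(h <- H) hweight c ED h.
Proof.
pose S F : R := \sum_(h <- H) hweight c ED h * F h.
have S0E : \sum_(h <- H) hweight c ED h = S (fun=> 1).
  by apply: eq_bigr => h _; rewrite mulr1.
have S1 : S (fun h => (h v)%:~R) = 2 * S (fun=> 1) - S (fun h => (h v)%:~R).
  rewrite /S {1}sum_reflect1 mulr_sumr -sumrB; apply: eq_bigr => h _.
  by rewrite /reflect1 intrB; ring.
(* Expansion of [(2 - t)^3]; together with [S1], which says that the mean is 1, this determines the
   third moment. *)
have S3 : S (fun h => (h v)%:~R ^+ 3) = 8 * S (fun=> 1)
    - 12 * S (fun h => (h v)%:~R) + 6 * S (fun h => (h v)%:~R ^+ 2)
    - S (fun h => (h v)%:~R ^+ 3).
  rewrite /S {1}sum_reflect1 !mulr_sumr -!sumrB -big_split -sumrB /=.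
  by apply: eq_bigr => h _; rewrite /reflect1 intrB; ring.
rewrite S0E -/(S (fun h => (h v)%:~R ^+ 3)) -/(S (fun h => (h v)%:~R ^+ 2)).
move: S1 S3; move: (S _) (S _) (S _) (S _) => s3 s2 s0 s1; lra.
Qed.

Lemma sqr_le_cube (t m : R) : 0 <= t -> 0 < m -> t ^+ 2 <= t ^+ 3 / m + m ^+ 2.
Proof.
move=> t0 m0; have [tm|mt] := leP t m.
  have q : 0 <= t ^+ 3 / m by rewrite divr_ge0 ?exprn_ge0// ltW.
  apply: (@le_trans _ _ (m ^+ 2)); last by rewrite lerDr.
  by rewrite lerXn2r ?nnegrE// ltW.
have -> : t ^+ 2 = t ^+ 2 * m / m by rewrite mulfK// gt_eqF.
rewrite -[leLHS]addr0 lerD ?sqr_ge0// ler_pM2r ?invr_gt0//.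
by rewrite [t ^+ 3]exprSr ler_wpM2l ?sqr_ge0// ltW.
Qed.

Lemma second_moment v (th : R) : 0 < th ->
  th * (\sum_(h <- H) hweight c ED h * `|(h v)%:~R| ^+ 3)
    <= \sum_(h <- H) hweight c ED h * (h v)%:~R ^+ 3 ->
  \sum_(h <- H) hweight c ED h * (h v)%:~R ^+ 2
    <= 72 / th ^+ 2 * \sum_(h <- H) hweight c ED h.
Proof.
move=> th0; rewrite cube_moment.
set S2 := \sum_(h <- H) _ * _ ^+ 2; set S0 := \sum_(h <- H) hweight c ED h.
set T3 := \sum_(h <- H) _ => le3.
(* With [m = 6 / th] the cubic term of [sqr_le_cube] is [th * T3 / 6], at most [S2 / 2], and is
   absorbed on the left. What remains is twice [(6 / th)^2], hence 72. *)
have m0 : 0 < 6 / th by rewrite divr_gt0.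
have le2 : S2 <= T3 / (6 / th) + (6 / th) ^+ 2 * S0.
  rewrite /S2 /T3 /S0 mulr_suml mulr_sumr -big_split /=; apply: ler_sum => h _.
  have := ler_wpM2l (hweight_ge0 h) (sqr_le_cube (normr_ge0 (h v)%:~R) m0).
  rewrite real_normK ?num_real// => /le_trans; apply.
  by rewrite mulrDr (mulrA _ (_ ^+ 3)) (mulrC _ (_ ^+ 2)).
have S00 : 0 <= S0 by apply: sumr_ge0 => h _; exact: hweight_ge0.
have thn : th != 0 by rewrite gt_eqF.
have -> : 72 / th ^+ 2 = 2 * (6 / th) ^+ 2 by field.
have e3 : T3 / (6 / th) = th * T3 / 6 by field.
rewrite -mulrA; rewrite e3 in le2; move: le3 le2 S00.
by move: (_ ^+ 2 * S0) (th * T3) => a b; lra.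
Qed.

End Finite.

Lemma height_var_le x K : 0 <= K ->
  (finite_set (heights VD ED) ->
   \sum_(h <- H) hweight c ED h * (h x)%:~R ^+ 2
     <= K * \sum_(h <- H) hweight c ED h) ->
  height_var c VD ED x <= K.
Proof.
move=> K0 le; have [finH|infH] := pselect (finite_set (heights VD ED)).
  apply: le_trans (hE_le finH K0 (le finH)).
  by rewrite /height_var gerBl sqr_ge0.
(* All weights are at least 1, so the sum has infinite support and takes its default value 0;
   division by it then makes the variance 0. *)
have Z0 : hZ c VD ED = 0.
  rewrite /hZ; apply: fsbig_dflt; rewrite setIidl// => h _ /=.
  by apply/eqP; rewrite gt_eqF// (lt_le_trans _ (hweight_ge1 h)).
by rewrite /height_var /hE Z0 invr0 !mulr0 expr0n /= subr0.
Qed.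

Hypotheses (irr : irreflexive adj) (symadj : symmetric adj).
Hypothesis subD : is_subgraph VD ED.

Lemma adj_edge u v : adj u v -> exists e : edge adj, joins e u v.
Proof.
move=> uv; have [lt|lt|eq] := ltngtP (choice.pickle u) (choice.pickle v).
- have p : edge_pred adj (u, v) by rewrite /edge_pred /= uv.
  by exists (exist _ (u, v) p); rewrite /joins /efst /esnd /= !eqxx.
- have p : edge_pred adj (v, u) by rewrite /edge_pred /= symadj uv.
  by exists (exist _ (v, u) p); rewrite /joins /efst /esnd /= !eqxx orbT.
- have e := pcan_inj (@choice.pickleK V) eq.
  by rewrite e irr in uv.
Qed.

(** Either every edge of the path belongs to the domain and [h] varies by at most 2 along each, or
    the first edge that does not starts at a boundary vertex, where [h = 1]. *)
Lemma height_path x s : x \in VD -> path adj x s ->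
  (last x s \in VD /\ forall h, height_fun VD ED h ->
     `|h x - h (last x s)| <= 2 * (size s)%:Z) \/
  (forall h, height_fun VD ED h -> `|h x - 1| <= 2 * (size s)%:Z).
Proof.
elim: s x => [|t s IH] x xD /=.
  by move=> _; left; split => // h _; rewrite subrr normr0 mulr0.
case/andP => xt pt; have [e j] := adj_edge xt.
have [eE|eE] := boolP (e \in ED); last first.
  right=> h [_ [_ [_ hb]]]; rewrite hb ?subrr ?normr0//.
  have [ix _] := joins_incident j.
  by split=> //; exists e.
have [tD ht] : t \in VD /\ forall h, height_fun VD ED h -> `|h x - h t| <= 2.
  have /andP[e1 e2] := subD eE; split.
    by case/orP: j => /andP[/eqP a /eqP b]; rewrite -?a -?b.
  move=> h [_ [_ [/(_ _ eE) h3 _]]].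
  by case/orP: j => /andP[/eqP <- /eqP <-]; rewrite // distrC.
case: (IH _ tD pt) => [[lD IH']|IH'].
  left; split=> // h hh; have := ht _ hh; have := IH' _ hh.
  by move: (h _) (h _) (h _); lia.
right=> h hh; have := ht _ hh; have := IH' _ hh.
by move: (h _) (h _); lia.
Qed.

End Moments.

(** * Exhaustion by balls *)

Section Exhaustion.
Variables (V : countType) (adj : rel V).
Hypotheses (irr : irreflexive adj) (symadj : symmetric adj).
Hypotheses (lf : locally_finite adj) (gc : graph_connected adj).
Variable o : V.

(** [wired_limit] speaks only along exhaustions, so one has to be exhibited. Local finiteness makes
    [fset_set] return the true set of neighbours. *)
Fixpoint gball (n : nat) : {fset V} :=
  if n is m.+1 then
    gball m `|` \bigcup_(v <- gball m) fset_set [set w | adj v w]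
  else [fset o].

Lemma gballSP n w :
  reflect (w \in gball n \/ exists2 v, v \in gball n & adj v w)
          (w \in gball n.+1).
Proof.
rewrite /= in_fsetU; apply: (iffP orP) => -[wn|]; try by left.
  case/bigfcupP => v; rewrite andbT => vn; rewrite in_fset_set// inE.
  by right; exists v.
case=> v vn vw; right; apply/bigfcupP; exists v; first by rewrite vn.
by rewrite in_fset_set// inE.
Qed.

Lemma gball_mono m n : (m <= n)%N -> gball m `<=` gball n.
Proof.
move/subnKC <-; elim: (n - m)%N => [|k IH]; first by rewrite addn0.
rewrite addnS; apply: fsubset_trans IH _; exact: fsubsetUl.
Qed.

Definition gball_edges (n : nat) : {fset edge adj} :=
  seq_fset tt (pmap insub [seq (u, v) | u <- gball n, v <- gball n]).

Lemma in_gball_edges n e :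
  (e \in gball_edges n) = (efst e \in gball n) && (esnd e \in gball n).
Proof.
rewrite seq_fsetE mem_pmap_sub; apply/allpairsP/andP => [[[u v] [/= un vn]]|[]].
  by move=> ee; split; rewrite /efst /esnd /= ee.
by move=> e1 e2; exists (efst e, esnd e); split => //=; exact: surjective_pairing.
Qed.

Definition reach (S : {fset edge adj}) (u v : V) : Prop :=
  exists s, path (linkE S) u s /\ last u s = v.

Lemma reach_trans S u v w : reach S u v -> reach S v w -> reach S u w.
Proof.
move=> [s [ps ls]] [t [pt lt]]; exists (s ++ t).
by rewrite cat_path last_cat ls ps.
Qed.

Lemma reach_sym S u v : reach S u v -> reach S v u.
Proof.
move=> [s [ps ls]]; exists (rev (belast u s)); split.
  rewrite -ls rev_path; rewrite (eq_path (e' := linkE S))// => a b.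
  exact: linkE_sym.
by case: s ps ls => [//|t s] _ _ /=; rewrite rev_cons last_rcons.
Qed.

Lemma reach_sub S S' u v : S `<=` S' -> reach S u v -> reach S' u v.
Proof.
move=> SS' [s [ps ls]]; exists s; split=> //; apply: sub_path ps => a b.
exact: linkE_sub.
Qed.

Lemma gball_edges_mono m n : (m <= n)%N -> gball_edges m `<=` gball_edges n.
Proof.
move=> mn; apply/fsubsetP => e; rewrite !in_gball_edges => /andP[e1 e2].
by move/fsubsetP: (gball_mono mn) => sub; rewrite !sub.
Qed.

Lemma reach_gball n v : v \in gball n -> reach (gball_edges n) o v.
Proof.
elim: n v => [|n IH] v; first by rewrite inE => /eqP ->; exists [::].
have up u : u \in gball n -> reach (gball_edges n.+1) o u.
  by move/IH; apply: reach_sub; exact: gball_edges_mono.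
move/gballSP => vn; case: (vn) => [/up//|[u un uv]].
apply: reach_trans (up _ un) _; exists [:: v]; split=> //=; rewrite andbT.
have [e j] := adj_edge irr symadj uv.
apply/hasP; exists e => //; rewrite in_gball_edges.
have un' : u \in gball n.+1 by apply/gballSP; left.
have vn' : v \in gball n.+1 by apply/gballSP.
by case/orP: j => /andP[/eqP -> /eqP ->]; apply/andP.
Qed.

Lemma mem_gball v : exists n, v \in gball n.
Proof.
have [s [ps <-]] := gc o v; exists (size s).
have : forall s n u, u \in gball n -> path adj u s ->
    last u s \in gball (n + size s)%N.
  elim=> [|t q IH] n u un /=; first by rewrite addn0.
  case/andP => ut pt; rewrite addnS -addSn; apply: IH => //.
  by apply/gballSP; right; exists u.
by move=> /(_ s 0%N o); rewrite add0n; apply => //; rewrite inE.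
Qed.

Lemma gball_exhaustion : exhaustion (fun n => (gball n, gball_edges n)).
Proof.
split; [|split; [|split]] => /=.
- move=> n; split=> [e|u v un vn]; first by rewrite in_gball_edges.
  apply: (reach_trans (reach_sym (reach_gball un))).
  exact: reach_gball.
- move=> n; split; first exact: (gball_mono (leqnSn n)).
  exact: (gball_edges_mono (leqnSn n)).
- exact: mem_gball.
- move=> e; have [m em] := mem_gball (efst e); have [n en] := mem_gball (esnd e).
  exists (maxn m n); rewrite in_gball_edges.
  move/fsubsetP: (gball_mono (leq_maxl m n)) => ->//=.
  by move/fsubsetP: (gball_mono (leq_maxr m n)) => ->.
Qed.

End Exhaustion.

Lemma exhaustion_sub (V : countType) (adj : rel V)
    (D : nat -> {fset V} * {fset edge adj})
    (VD : {fset V}) (ED : {fset edge adj}) :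
  exhaustion D ->
  exists N, forall n, (N <= n)%N -> VD `<=` (D n).1 /\ ED `<=` (D n).2.
Proof.
move=> [_ [mono [vex eex]]].
have monoV m n : (m <= n)%N -> (D m).1 `<=` (D n).1.
  move/subnKC <-; elim: (n - m)%N => [|k IH]; first by rewrite addn0.
  by rewrite addnS; apply: fsubset_trans IH (proj1 (mono _)).
have monoE m n : (m <= n)%N -> (D m).2 `<=` (D n).2.
  move/subnKC <-; elim: (n - m)%N => [|k IH]; first by rewrite addn0.
  by rewrite addnS; apply: fsubset_trans IH (proj2 (mono _)).
have [N1 H1] : exists N, VD `<=` (D N).1.
  elim/fset_ind1U: VD => [|v F vF [N IH]]; first by exists 0%N.
  have [M vM] := vex v; exists (maxn M N); rewrite fsubUset fsub1set.
  apply/andP; split; last by apply: fsubset_trans IH (monoV _ _ (leq_maxr _ _)).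
  by move/fsubsetP: (monoV _ _ (leq_maxl M N)); exact.
have [N2 H2] : exists N, ED `<=` (D N).2.
  elim/fset_ind1U: ED => [|v F vF [N IH]]; first by exists 0%N.
  have [M vM] := eex v; exists (maxn M N); rewrite fsubUset fsub1set.
  apply/andP; split; last by apply: fsubset_trans IH (monoE _ _ (leq_maxr _ _)).
  by move/fsubsetP: (monoE _ _ (leq_maxl M N)); exact.
exists (maxn N1 N2) => n; rewrite geq_max => /andP[n1 n2]; split.
  exact: fsubset_trans H1 (monoV _ _ n1).
exact: fsubset_trans H2 (monoE _ _ n2).
Qed.

(** * Infinite clusters and the infinite-volume limit *)

Section Percolation.
Variables (V : countType) (adj : rel V) (R : realType) (c : edge adj -> R).
Implicit Types om : Omega adj.

Local Notation open_path om := (path (fun a b => `[< open_link om a b >])).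

Lemma measurable_cyl F xi : measurable (cyl F xi : set (Omega adj)).
Proof. by apply: sub_sigma_algebra; exists F, xi. Qed.

Lemma measurable_open_link u v :
  measurable [set om : Omega adj | open_link om u v].
Proof.
rewrite (_ : mkset _ = \bigcup_(e : edge adj)
    (if joins e u v then cyl [fset e] xpredT else set0)).
  apply: countable_bigcupT_measurable; first exact: countableP.
  by move=> e; case: ifP => // _; exact: measurable_cyl.
apply/seteqP; split=> [om [e [oe j]]|om [e _]].
  by exists e => //=; rewrite j => f; rewrite inE => /eqP ->.
by case: ifP => // j /(_ e); rewrite inE eqxx => /(_ isT) oe; exists e.
Qed.

Lemma measurable_open_path v s :
  measurable [set om : Omega adj | open_path om v s].
Proof.
elim: s v => [|t s IH] v /=.
  by rewrite (_ : mkset _ = setT)//; apply/seteqP; split.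
rewrite (_ : mkset _ = [set om : Omega adj | open_link om v t] `&`
    [set om | open_path om t s])%classic.
  by apply: measurableI; [exact: measurable_open_link|exact: IH].
apply/seteqP; split=> om /=; first by case/andP => /asboolP.
by move=> [vt ts]; apply/andP; split=> //; exact/asboolP.
Qed.

(** Rewrites infinitude with countable quantifiers only, so that [inf_at] becomes a countable
    intersection of countable unions over finite paths. *)
Lemma infinite_pickle (A : set V) :
  infinite_set A <-> forall k, exists2 w, A w & (k <= choice.pickle w)%N.
Proof.
split=> [infA k|unb /finite_fsetP[X AX]].
  apply: contrapT => no; apply: infA.
  apply: (@sub_finite_set _ _ ((@choice.pickle V) @^-1` `I_k)).
    move=> w Aw /=; rewrite ltnNge; apply/negP => kw.
    by apply: no; exists w.
  apply: finite_preimage; last exact: finite_II.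
  by move=> u v _ _; exact: (pcan_inj (@choice.pickleK V)).
have [w] := unb (\max_(w <- X) choice.pickle w).+1.
rewrite AX /= => wX; apply/negP; rewrite -leqNgt.
exact: leq_bigmax_seq.
Qed.

Definition inf_at (v : V) : set (Omega adj) :=
  [set om | infinite_set (Defs.cluster om v)].

Lemma measurable_inf_at v : measurable (inf_at v).
Proof.
rewrite (_ : inf_at v = \bigcap_k \bigcup_(s : seq V)
    (if (k <= choice.pickle (last v s))%N then [set om | open_path om v s]
     else set0)).
  apply: bigcapT_measurable => k; apply: countable_bigcupT_measurable.
    exact: countableP.
  by move=> s; case: ifP => // _; exact: measurable_open_path.
apply/seteqP; split=> om.
  move/infinite_pickle => H k _; have [w [s [ps ls]] kw] := H k.
  by exists s => //=; rewrite ls kw.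
move=> H; apply/infinite_pickle => k; have [s _] := H k I.
by case: ifP => // kw ps; exists (last v s) => //; exists s.
Qed.

Lemma inf_clusterE : @inf_cluster V adj = \bigcup_v inf_at v.
Proof. by apply/seteqP; split=> om [v]; [exists v|exists v]. Qed.

Lemma inf_at_gt0 (mu : probability (Omega adj) R) :
  mu (@inf_cluster V adj) = 1%E -> exists v, (0 < mu (inf_at v))%E.
Proof.
move=> mu1; apply: contrapT => no.
have null v : mu (inf_at v) = 0%E.
  apply/eqP; rewrite eq_le measure_ge0 andbT leNgt; apply/negP => lt.
  by apply: no; exists v.
pose F k := if choice.unpickle k is Some v then inf_at v else set0.
have UF : @inf_cluster V adj = \bigcup_k F k.
  rewrite inf_clusterE; apply/seteqP; split=> om [v _].
    by exists (choice.pickle v) => //; rewrite /F choice.pickleK.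
  by rewrite /F; case: choice.unpickle => // u; exists u.
have negl : mu.-negligible (\bigcup_k F k).
  apply: negligible_bigcup => k; rewrite /F; case: choice.unpickle => [v|].
    by apply/negligibleP; [exact: measurable_inf_at|exact: null].
  exact: negligible_set0.
move: mu1; rewrite UF (measure_negligible _ negl).
  by move/eqP; rewrite eq_sym onee_eq0.
apply: bigcupT_measurable => k; rewrite /F.
by case: choice.unpickle => // v; exact: measurable_inf_at.
Qed.

Section Domain.
Variables (VD : {fset V}) (ED : {fset edge adj}).
Hypothesis c_ge1 : forall e, 1 <= c e.
Hypothesis subD : is_subgraph VD ED.

(** An infinite cluster leaves the finite set [VD]; the first edge outside [ED] on an open path
    leaving it starts at a boundary vertex. *)
Lemma inf_at_bconn om (z : VD) : infinite_set (Defs.cluster om (val z)) ->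
  bconn ED [fset e in ED | om e] z.
Proof.
move=> infc.
have [w cw wD] : exists2 w, Defs.cluster om (val z) w & w \notin VD.
  apply: contrapT => no; apply: infc.
  apply: (@sub_finite_set _ _ [set` VD]); last exact: finite_fset.
  by move=> w cw /=; apply: contrapT => /negP wD; apply: no; exists w.
case: cw => s [ps ls]; rewrite -ls {ls} in wD.
elim: s z {infc} ps wD => [|t s IH] z /=; first by rewrite (valP z).
case/andP => /asboolP[e [oe j]] pt wD.
have [eE|eE] := boolP (e \in ED); last first.
  apply/existsP; exists z; rewrite connect0 andbT; apply/asboolP.
  by apply: bdry_out eE; have [] := joins_incident j.
have tD : t \in VD.
  have /andP[e1 e2] := subD eE.
  by case/orP: j => /andP[/eqP a /eqP b]; rewrite -?a -?b.
apply: (@bconn_connect _ _ _ _ _ [` tD]); first exact: IH.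
rewrite wired_connect_sym; apply: connect1; apply/orP; left.
by apply/hasP; exists e => //; rewrite !inE eE.
Qed.

Lemma mu_inf_at_le (mu : probability (Omega adj) R) (z : VD) :
  fine (mu (inf_at (val z))) <=
  \sum_(w <- fpowerset ED | bconn ED w z) fine (mu (cyl ED (fun e => e \in w))).
Proof.
have fin w : mu (cyl ED (fun e => e \in w)) \is a fin_num.
  by apply: fin_num_measure; exact: measurable_cyl.
rewrite -lee_fin fineK; last by apply: fin_num_measure; exact: measurable_inf_at.
rewrite EFin_sum_fine//.
rewrite big_fset_condE /=.
set G := [fset w in fpowerset ED | bconn ED w z].
have := @content_sub_fsum _ _ _ mu _ [set` G] (inf_at (val z))
  (fun w => cyl ED (fun e => e \in w)).
rewrite -fsbig_seq ?fset_uniq//; apply.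
- exact: finite_fset.
- by move=> w _; exact: measurable_cyl.
- exact: measurable_inf_at.
move=> om /inf_at_bconn bz; exists [fset e in ED | om e] => /=.
  rewrite in_fset_filter bz andbT fpowersetE.
  by apply/fsubsetP => e; rewrite !inE => /andP[].
by move=> e eE; rewrite !inE eE.
Qed.

Section Volume.
Variables (Vn : {fset V}) (En : {fset edge adj}).

Lemma fk_partition_gt0 : 0 < \sum_(w <- fpowerset En) fk_weight c Vn En w.
Proof.
have mem0 : fset0 \in fpowerset En by rewrite fpowersetE fsub0set.
(* The empty configuration already has positive weight, since [1 - pe = 1/c]. *)
rewrite (big_fsetD1 fset0)//= ltr_wpDr//.
  by apply: sumr_ge0 => w _; exact: fk_weight_ge0.
rewrite /fk_weight mulr_gt0 ?exprn_gt0//; apply: prodr_gt0 => e _.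
rewrite /pe opprB addrCA subrr addr0 invr_gt0.
exact: lt_le_trans (c_ge1 e).
Qed.

Lemma fk_cyl_sum (Q : pred {fset edge adj}) :
  (forall w, Q (w `&` ED) = Q w) ->
  \sum_(w <- fpowerset ED | Q w) fk_cyl_prob c Vn En ED (fun e => e \in w)
  = (\sum_(w <- fpowerset En | Q w) fk_weight c Vn En w)
    / \sum_(w <- fpowerset En) fk_weight c Vn En w.
Proof.
move=> QI; rewrite -mulr_suml; congr (_ / _).
rewrite (exchange_big_dep Q) /=; last first.
  move=> k w Qk /allP m; rewrite -QI (_ : _ `&` _ = k `&` ED) ?QI//.
  apply/fsetP => e; rewrite !inE; have [eE|] := boolP (e \in ED).
    by rewrite !andbT; apply/eqP; exact: m.
  by rewrite !andbF.
rewrite big_seq_cond [RHS]big_seq_cond; apply: eq_bigr => w /andP[wE Qw].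

(* Exactly one pattern on [ED] matches [w], namely its trace there. *)
have mem : w `&` ED \in fpowerset ED by rewrite fpowersetE fsubsetIr.
rewrite big_mkcond (big_fsetD1 (w `&` ED))//= QI Qw /=.
have -> : all (fun e => (e \in w) == (e \in w `&` ED)) ED.
  by apply/allP => e eE; rewrite !inE eE andbT.
rewrite big_seq big1 ?addr0// => k.
rewrite !inE fpowersetE => /andP[kw kE]; case: ifP => // /andP[_ /allP m].
case/eqP: kw; apply/fsetP => e; rewrite !inE.
have [eE|eE] := boolP (e \in ED); first by rewrite andbT (eqP (m _ eE)).
by rewrite andbF; apply/negbTE; apply: contra eE; move/fsubsetP: kE; exact.
Qed.

End Volume.

Lemma cvg_sum_seq (I : Type) (r : seq I) (P : pred I) (f : I -> nat -> R)
    (l : I -> R) : (forall i, f i @ \oo --> l i) ->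
  (fun n => \sum_(i <- r | P i) f i n) @ \oo --> \sum_(i <- r | P i) l i.
Proof.
move=> fl; elim: r => [|i r IH].
  rewrite big_nil; under eq_fun do rewrite big_nil; exact: cvg_cst.
rewrite big_cons; under eq_fun do rewrite big_cons.
by case: (P i) => //; apply: cvgD.
Qed.

(** The domain lies in all large volumes of the exhaustion, where the hypothesis bounds the FK
    probability of [bconn]; as a finite sum of cylinder probabilities this converges to a bound for
    [inf_at]. *)
Lemma fk_limit_le (mu : probability (Omega adj) R)
    (D : nat -> {fset V} * {fset edge adj}) (z : VD) (S T : R) :
  exhaustion D -> wired_limit c mu -> 0 <= T ->
  (forall (Vn : {fset V}) (En : {fset edge adj}), VD `<=` Vn -> ED `<=` En ->
    (\sum_(w <- fpowerset En | bconn ED w z) fk_weight c Vn En w) * T <=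
    (\sum_(w <- fpowerset En) fk_weight c Vn En w) * S) ->
  fine (mu (inf_at (val z))) * T <= S.
Proof.
move=> exD lim T0 H.
apply: le_trans (ler_wpM2r T0 (mu_inf_at_le mu z)) _.
have cv := @cvg_sum_seq _ (fpowerset ED) (bconn ED ^~ z) _ _
  (fun w => lim D exD ED (fun e => e \in w)).
have cvT := cvgM cv (cvg_cst T (F := \oo)).
have cS : (fun=> S : R) @ \oo --> S by exact: cvg_cst.
apply: (ler_cvg_to (cvT _ _) cS).
have [N HN] := exhaustion_sub VD ED exD.
exists N => // n /= Nn; have [sV sE] := HN _ Nn.
rewrite fk_cyl_sum; last by move=> w; exact: bconnI.
by rewrite mulrAC ler_pdivrMr ?fk_partition_gt0// [leRHS]mulrC; exact: H.
Qed.

End Domain.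

End Percolation.

(** * The variance bound at [x] *)

Theorem mainTheorem2 (R : realType) (V : countType) (adj : rel V)
    (c : edge adj -> R) (x : V) :
  irreflexive adj -> symmetric adj ->
  infinite_set [set: V] ->
  locally_finite adj ->
  graph_connected adj ->
  (forall e, 1 <= c e) ->
  (exists mu : probability (Omega adj) R,
      wired_limit c mu /\ mu (@inf_cluster V adj) = 1%E) ->
  exists C : R, 0 < C /\
    forall (VD : {fset V}) (ED : {fset edge adj}),
      is_subgraph VD ED -> sub_connected VD ED -> x \in VD ->
      height_var c VD ED x <= C.
Proof.
move=> irr symadj _ lf gc c1 [mu [lim mu1]].
have [y muy] := inf_at_gt0 mu1.
have [s [ps ls]] := gc x y.
pose th := fine (mu (inf_at y)).
have th0 : 0 < th.
  rewrite /th fine_gt0// muy /= -ge0_fin_numE ?measure_ge0//.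
  by apply: fin_num_measure; exact: measurable_inf_at.
pose L : R := 2 * (size s)%:R.
have K0 : 0 <= 72 / th ^+ 2 by rewrite divr_ge0 ?exprn_ge0// ltW.
(* The first two terms carry the second moment from [y] to [x] at height distance [L]; the final 2
   serves the case where the path meets the boundary and [h(y)] is replaced by 1. *)
pose C : R := 2 * (72 / th ^+ 2) + 2 * L ^+ 2 + 2.
have L2 := sqr_ge0 L.
exists C; split; first by rewrite /C; lra.
move=> VD ED subD _ xD; apply: height_var_le => //; first by rewrite /C; lra.
move=> finH.
have W0 h : 0 <= hweight c ED h by exact: hweight_ge0.
have S0 : 0 <= \sum_(h <- hset VD ED) hweight c ED h by exact: sumr_ge0.
have sqr_bound (a b : R) : `|a - b| <= L -> a ^+ 2 <= 2 * b ^+ 2 + 2 * L ^+ 2.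
  rewrite -ler_sqr ?nnegrE ?normr_ge0 ?mulr_ge0// real_normK ?num_real//.
  (* [2 b^2 + 2 (a - b)^2 - a^2 = (a - 2 b)^2]. *)
  by have := sqr_ge0 (a - 2 * b); nra.
have cast (a b : int) : `|a - b| <= 2 * (size s)%:Z ->
    `|a%:~R - b%:~R| <= L :> R.
  by rewrite -intrB -intr_norm -(ler_int R) intrM.
case: (height_path irr symadj subD xD ps) => [[yD hp]|hp].
  rewrite ls in yD hp.
  have mom : \sum_(h <- hset VD ED) hweight c ED h * (h y)%:~R ^+ 2
      <= 72 / th ^+ 2 * \sum_(h <- hset VD ED) hweight c ED h.
    apply: second_moment => //.
    apply: (@fk_limit_le _ _ _ c _ _ c1 subD mu _ [` yD] _ _
      (gball_exhaustion irr symadj lf gc x) lim).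
      by apply: sumr_ge0 => h _; rewrite mulr_ge0// exprn_ge0.
    by move=> Vn En sV sE; exact: cube_moment_ge.
  apply: (@le_trans _ _ (2 * (\sum_(h <- hset VD ED) hweight c ED h * (h y)%:~R ^+ 2)
    + 2 * L ^+ 2 * \sum_(h <- hset VD ED) hweight c ED h)).
    rewrite !mulr_sumr -big_split /= big_seq [leRHS]big_seq.
    apply: ler_sum => h; rewrite in_hset// => /asboolP hh.
    have := ler_wpM2l (W0 h) (sqr_bound _ _ (cast _ _ (hp _ hh))).
    by move/le_trans; apply; rewrite mulrDr [X in X + _]mulrCA lerD2l mulrC.
  by rewrite /C !mulrDl -!mulrA; lra.
rewrite mulr_sumr big_seq [leRHS]big_seq.
apply: ler_sum => h; rewrite in_hset// => /asboolP hh.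
rewrite [leRHS]mulrC; apply: ler_wpM2l => //.
have := sqr_bound _ _ (cast _ _ (hp _ hh)).
by rewrite expr1n /C; lra.
Qed.
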